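(* Let $X$ be a Banach space and let $\mathbb{A}_X$ be the group of linear homeomorphic isomorphisms of $X$ onto itself. There is a bijective correspondence between cotranslations $Z:\mathbb{Z}\times\mathbb{Z}\to \mathbb{A}_X$ and nonautonomous linear difference equations $x(n+1)=A(n)x(n)$ with $\mathbb{Z}\ni n\mapsto A(n)\in \mathbb{A}_X$, where the correspondence is given by $$Z(n,m)= \begin{cases} A(n+m-1)A(n+m-2)\cdots A(n) & \text{if } m>0,\\ \mathrm{Id} & \text{if } m=0,\\ A^{-1}(n+m)A^{-1}(n+m+1)\cdots A^{-1}(n-1) & \text{if } m<0.\end{cases}$$
   Context: Here $A^{-1}(j)$ denotes $A(j)^{-1}$. A nonautonomous linear difference equation $x(n+1)=A(n)x(n)$ is identified with the function $n\mapsto A(n)$. A cotranslation $Z:\mathbb{Z}\times\mathbb{Z}\to\mathbb{A}_X$ is a groupoid morphism from the left translations groupoid of $\mathbb{Z}$ to the group $\mathbb{A}_X$; explicitly, a map satisfying $Z(n,k+m)=Z(m+n,k)\circ Z(n,m)$ for all $n,m,k\in\mathbb{Z}$. *)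

(* Defs.v *)
From HB Require Import structures.
From mathcomp Require Import all_boot all_order all_algebra.
From mathcomp Require Import all_classical all_reals all_analysis.

Set Implicit Arguments.
Unset Strict Implicit.
Unset Printing Implicit Defensive.

Import Order.TTheory GRing.Theory Num.Theory.
Import numFieldNormedType.Exports.

Local Open Scope classical_set_scope.
Local Open Scope ring_scope.

(* The scalar field is an arbitrary numFieldType, so that real and complex
   Banach spaces are both covered. The inverse map is part of the data; being
   determined by the map itself, it does not affect equality (linHomeo_ext). *)
Record linHomeo (K : numFieldType) (X : normedModType K) := LinHomeo {
  homeo_fun :> X -> X;
  homeo_inv : X -> X;
  homeo_linear : linear homeo_fun;
  homeo_continuous : continuous homeo_fun;
  homeo_inv_continuous : continuous homeo_inv;
  homeo_funK : cancel homeo_fun homeo_inv;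
  homeo_invK : cancel homeo_inv homeo_fun
}.

Section LinHomeoGroup.
Context {K : numFieldType} {X : normedModType K}.
Implicit Types f g h : linHomeo X.

Lemma linHomeo_ext f g : homeo_fun f =1 homeo_fun g -> f = g.
Proof.
case: f g => [f f' lf cf cf' fK f'K] [g g' lg cg cg' gK g'K] /= /funext efg.
subst g; have efg' : f' = g' by apply/funext => x; rewrite -{1}(g'K x) fK.
by subst g'; congr LinHomeo; exact: Prop_irrelevance.
Qed.

Lemma homeo_inv_linear f : linear (homeo_inv f).
Proof.
move=> a x y; apply: (can_inj (homeo_funK f)).
by rewrite !(homeo_linear, homeo_invK).
Qed.

Lemma id_linear : linear (@id X).
Proof. by []. Qed.

Lemma id_continuous : continuous (@id X).
Proof. by move=> x; exact: cvg_id. Qed.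

Definition linHomeo_one : linHomeo X :=
  LinHomeo id_linear id_continuous id_continuous
    (fun=> erefl) (fun=> erefl).

Lemma comp_linear f g : linear (f \o g).
Proof. by move=> a x y /=; rewrite !homeo_linear. Qed.

Lemma comp_continuous f g : continuous (f \o g).
Proof. by move=> x; apply: continuous_comp; exact: homeo_continuous. Qed.

Lemma comp_inv_continuous f g : continuous (homeo_inv g \o homeo_inv f).
Proof. by move=> x; apply: continuous_comp; exact: homeo_inv_continuous. Qed.

Definition linHomeo_mul f g : linHomeo X :=
  LinHomeo (@comp_linear f g) (@comp_continuous f g)
    (@comp_inv_continuous f g)
    (can_comp (@homeo_funK _ _ f) (@homeo_funK _ _ g))
    (can_comp (@homeo_invK _ _ g) (@homeo_invK _ _ f)).

Definition linHomeo_inv f : linHomeo X :=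
  LinHomeo (@homeo_inv_linear f) (@homeo_inv_continuous _ _ f)
    (@homeo_continuous _ _ f) (@homeo_invK _ _ f) (@homeo_funK _ _ f).

Lemma linHomeo_mulA : associative linHomeo_mul.
Proof. by move=> f g h; exact: linHomeo_ext. Qed.

Lemma linHomeo_mul1 : left_id linHomeo_one linHomeo_mul.
Proof. by move=> f; exact: linHomeo_ext. Qed.

Lemma linHomeo_mulr1 : right_id linHomeo_one linHomeo_mul.
Proof. by move=> f; exact: linHomeo_ext. Qed.

Lemma linHomeo_mulV : left_inverse linHomeo_one linHomeo_inv linHomeo_mul.
Proof. by move=> f; apply: linHomeo_ext => x /=; rewrite homeo_funK. Qed.

Lemma linHomeo_mulrV : right_inverse linHomeo_one linHomeo_inv linHomeo_mul.
Proof. by move=> f; apply: linHomeo_ext => x /=; rewrite homeo_invK. Qed.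

End LinHomeoGroup.

HB.instance Definition _ (K : numFieldType) (X : normedModType K) :=
  gen_eqMixin (linHomeo X).
HB.instance Definition _ (K : numFieldType) (X : normedModType K) :=
  gen_choiceMixin (linHomeo X).
HB.instance Definition _ (K : numFieldType) (X : normedModType K) :=
  isGroup.Build (linHomeo X) linHomeo_mulA linHomeo_mul1 linHomeo_mulr1
    linHomeo_mulV linHomeo_mulrV.

Definition cotranslation (G : groupType) (Z : int -> int -> G) : Prop :=
  forall n k m : int, Z n (k + m) = (Z (m + n) k * Z n m)%g.

(* The products \prod_(i < r) F i are ordered from left to right:
   F 0 * F 1 * ... * F r.-1. *)
Definition cotranslation_of (G : groupType) (A : int -> G) (n m : int) : G :=
  if 0 < m then (\prod_(i < `|m|%N) A (n + m - 1 - i%:Z)%R)%g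
  else if m == 0 then 1%g
  else (\prod_(i < `|m|%N) (A (n + m + i%:Z)%R)^-1)%g.

(* Main.v *)
(** In any group, the cotranslation attached to [A] is the unique [Z] with
    [Z n 0 = 1] and [Z n (m + 1) = A (n + m) * Z n m] for all integers [m].
    Both sides of the cotranslation identity solve the same first-order
    recurrence in [k], so they agree; conversely a cotranslation [Z] solves the
    recurrence for [A n := Z n 1], which also recovers [A] from [Z]. *)

Require Import Defs.
From HB Require Import structures.
From mathcomp Require Import all_boot all_order all_algebra.
From mathcomp Require Import all_classical all_reals all_analysis.
From mathcomp Require Import ring.

Set Implicit Arguments.
Unset Strict Implicit.
Unset Printing Implicit Defensive.

Import Order.TTheory GRing.Theory Num.Theory.
Import numFieldNormedType.Exports.

Local Open Scope classical_set_scope.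
Local Open Scope ring_scope.

(** Induction on [int] in both directions: upwards the recurrence applies directly, downwards it is
    inverted by cancelling [a m] in the group. *)
Lemma recurrence_unique (G : groupType) (a f g : int -> G) :
  f 0 = g 0 ->
  (forall m, f (m + 1) = (a m * f m)%g) ->
  (forall m, g (m + 1) = (a m * g m)%g) ->
  f =1 g.
Proof.
move=> fg0 fS gS; elim/int_rec => // k fgk.
  by rewrite -addn1 PoszD fS gS fgk.
by apply: (mulgI (a (- k.+1%:Z))); rewrite -fS -gS -addn1 PoszD opprD addrNK.
Qed.

Section CotranslationOf.
Context {G : groupType}.
Implicit Types (A : int -> G) (Z : int -> int -> G) (n m : int).

(** The empty product absorbs the case [m = 0], here and for negative arguments. *)
Lemma cotranslation_ofP A n (k : nat) :
  cotranslation_of A n k%:Z = (\prod_(i < k) A (n + k%:Z - 1 - i%:Z)%R)%g.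
Proof. by case: k => [|k]; rewrite /cotranslation_of //= big_ord0. Qed.

Lemma cotranslation_ofN A n (k : nat) :
  cotranslation_of A n (- k%:Z) = (\prod_(i < k) (A (n - k%:Z + i%:Z)%R)^-1)%g.
Proof.
by case: k => [|k]; rewrite /cotranslation_of ?oppr0 ?big_ord0 //= abszN.
Qed.

Lemma cotranslation_of0 A n : cotranslation_of A n 0 = 1%g.
Proof. by []. Qed.

Lemma cotranslation_ofS A n m :
  cotranslation_of A n (m + 1) = (A (n + m)%R * cotranslation_of A n m)%g.
Proof.
case: (intP m) => [|k|k].
- rewrite add0r (cotranslation_ofP _ _ 1) big_ord1 cotranslation_of0 mulg1.
  by rewrite subr0 addrK addr0.
- rewrite -PoszD addn1 !cotranslation_ofP big_ord_recl; congr (A _ * _)%g.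
    by rewrite subr0 intS; ring.
  apply: eq_bigr => i _; congr (A _).
  by rewrite lift0 !intS; ring.
(* The product for [- k.+1] starts with the inverse of [A (n - k.+1)], which the new factor
   cancels. *)
- have -> : - k.+1%:Z + 1 = - k%:Z by rewrite intS; ring.
  rewrite !cotranslation_ofN big_ord_recl addr0 mulVKg.
  apply: eq_bigr => i _; congr (A _)^-1%g.
  by rewrite lift0 !intS; ring.
Qed.

Lemma cotranslation_of1 A n : cotranslation_of A n 1 = A n.
Proof.
by rewrite -[1]add0r cotranslation_ofS cotranslation_of0 mulg1 addr0.
Qed.

Lemma cotranslation_of_cotranslation A : cotranslation (cotranslation_of A).
Proof.
move=> n k m; move: k.
(* With [n] and [m] fixed, both sides are functions of [k] with the same value at [0]. *)
apply: (@recurrence_unique _ (fun k => A (n + m + k))) => [|k|k].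
- by rewrite add0r cotranslation_of0 mul1g.
- by rewrite addrAC cotranslation_ofS; congr (A _ * _)%g; ring.
- by rewrite cotranslation_ofS mulgA (addrC m n).
Qed.

(** Taking [k = m = 0] makes [Z n 0] idempotent, hence trivial in a group. *)
Lemma cotranslation0 Z n : cotranslation Z -> Z n 0 = 1%g.
Proof.
by move=> /(_ n 0 0); rewrite !add0r -{1}[Z n 0]mul1g => /mulIg.
Qed.

Lemma cotranslation_ofK Z :
  cotranslation Z -> cotranslation_of (fun n => Z n 1) = Z.
Proof.
move=> cZ; apply/funext => n; apply/funext.
apply: (@recurrence_unique _ (fun m => Z (n + m) 1)) => [|m|m].
- by rewrite (cotranslation0 _ cZ).
- by rewrite cotranslation_ofS.
(* The recurrence is the cotranslation identity with [k = 1]. *)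
- by rewrite addrC cZ (addrC m n).
Qed.

Lemma cotranslation_of_inj : injective (@cotranslation_of G).
Proof.
move=> A B eAB; apply/funext => n.
by rewrite -[A n]cotranslation_of1 eAB cotranslation_of1.
Qed.

End CotranslationOf.

Theorem proposition3p16 (K : numFieldType) (X : completeNormedModType K) :
  set_bij [set: int -> linHomeo X]
    [set Z : int -> int -> linHomeo X | cotranslation Z]
    (fun A : int -> linHomeo X => cotranslation_of A).
Proof.
split=> [A _|A B _ _|Z cZ].
- exact: cotranslation_of_cotranslation.
- exact: cotranslation_of_inj.
- by exists (fun n => Z n 1) => //; exact: cotranslation_ofK.
Qed.
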